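(* If $L$ and $R$ are oriented graphs with $\operatorname{inv}(L)=\operatorname{inv}(R)=2$, then $\operatorname{inv}(L\rightarrow R)=4$.
   Context: All digraphs are oriented graphs: directed graphs without loops, digons or parallel edges. For a digraph $D$ and $X\subseteq V(D)$, inverting $X$ in $D$ means reversing the direction of every edge with both endpoints in $X$. A family $X_1,\dots,X_k\subseteq V(D)$ is a decycling family of $D$ if inverting $X_1,\dots,X_k$ in turn yields an acyclic digraph; $\operatorname{inv}(D)$ is the minimum size of a decycling family of $D$. For oriented graphs $L,R$, the dijoin $L\rightarrow R$ consists of vertex-disjoint copies of $L$ and $R$ together with an edge $\vec{uv}$ for every $u\in V(L)$, $v\in V(R)$. *)

(* Defs.v *)
From mathcomp Require Import all_boot.

Set Implicit Arguments.
Unset Strict Implicit.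
Unset Printing Implicit Defensive.

(* Asymmetry excludes loops as well as digons; parallel edges are excluded by  *)
(* edges being a relation.                                                     *)
Record oriented_graph := OrientedGraph {
  vertex :> finType;
  edge : rel vertex;
  edge_asym : forall x y, edge x y -> ~~ edge y x
}.

Definition invert_rel (D : oriented_graph) (X : {set D}) : rel D :=
  fun x y => if (x \in X) && (y \in X) then edge y x else edge x y.

Lemma invert_asym (D : oriented_graph) (X : {set D}) (x y : D) :
  invert_rel X x y -> ~~ invert_rel X y x.
Proof. by rewrite /invert_rel andbC; case: ifP => _ /edge_asym. Qed.

Definition invert (D : oriented_graph) (X : {set D}) : oriented_graph :=
  OrientedGraph (@invert_asym D X).

Fixpoint invert_family (D : oriented_graph) (s : seq {set D}) : oriented_graph :=
  if s is X :: s' then @invert_family (invert X) s' else D.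

Definition acyclic (D : oriented_graph) : Prop :=
  forall c : seq D, ucycle (@edge D) c -> c = [::].

Definition decycling (D : oriented_graph) (s : seq {set D}) : Prop :=
  acyclic (invert_family s).

Definition acyclicb (D : oriented_graph) : bool :=
  [forall x : D, forall y : D, edge x y ==> ~~ connect (@edge D) y x].

Lemma acyclicP (D : oriented_graph) : reflect (acyclic D) (acyclicb D).
Proof.
apply: (iffP forallP) => [acD [//|x p] /andP[] | acD x].
  rewrite /= rcons_path => /andP[pth elast] _.
  have /forallP/(_ x)/implyP/(_ elast)/negP[] := acD (last x p).
  by apply/connectP; exists p.
apply/forallP => y; apply/implyP => exy; apply/negP => /connectP[p pth def_x].
case/shortenP: pth def_x => p' pth' uniq' _ def_x.
suff: y :: p' = [::] by [].
by apply: acD; rewrite /ucycle /= rcons_path pth' -def_x exy.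
Qed.

Definition has_decycling (D : oriented_graph) (k : nat) : bool :=
  [exists s : k.-tuple {set D}, acyclicb (invert_family s)].

Lemma has_decyclingP (D : oriented_graph) (k : nat) :
  reflect (exists2 s : seq {set D}, size s = k & decycling s)
          (has_decycling D k).
Proof.
apply: (iffP existsP) => [[s /acyclicP acs] | [s sz acs]].
  by exists s; first exact: size_tuple.
move/eqP: sz => sz; exists (Tuple sz); exact/acyclicP.
Qed.

Lemma decycling_exists (D : oriented_graph) : exists k, has_decycling D k.
Proof.
suff [s acs]: exists s : seq {set D}, decycling s.
  by exists (size s); apply/has_decyclingP; exists s.
case: D => V e0 e0_asym.
pose back (e : rel V) :=
  [set u : V * V | e u.1 u.2 && (enum_rank u.2 < enum_rank u.1)].
have [n] := ubnP #|back e0|; elim: n => // n IHn in e0 e0_asym *; rewrite ltnS.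
have [b0 _ | [[x y]]] := set_0Vmem (back e0).
  exists [::]; apply/acyclicP; apply/forallP => x; apply/forallP => y.
  have le_e (u v : V) : e0 u v -> enum_rank u <= enum_rank v.
    move=> euv; rewrite leqNgt; apply/negP => lt_vu.
    by have := in_set0 (u, v); rewrite -b0 inE /= euv lt_vu.
  have le_p (p : seq V) (u : V) :
      path e0 u p -> enum_rank u <= enum_rank (last u p).
    elim: p u => //= v p IHp u /andP[/le_e le_uv /IHp]; exact: leq_trans.
  apply/implyP => exy; apply/negP => /connectP[p /le_p le_yx def_x].
  have rxy: x = y.
    apply/enum_rank_inj/val_inj/eqP.
    by rewrite eqn_leq le_e // [x in _ <= enum_rank x]def_x.
  by move: exy (e0_asym _ _ exy); rewrite /= rxy => ->.
rewrite inE /= => /andP[exy lt_yx] leb.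
pose D0 := OrientedGraph e0_asym; pose X : {set V} := [set x; y].
have ne_xy : x != y by apply: contraTneq lt_yx => ->; rewrite ltnn.
have sub : back (@invert_rel D0 X) \subset back e0 :\ (x, y).
  apply/subsetP => [[u v]]; rewrite !inE /invert_rel /= !inE.
  have nyx := e0_asym _ _ exy; have nxx w : e0 w w = false.
    by apply/negP => eww; move: (e0_asym _ _ eww); rewrite eww.
  case: ifP => [/andP[/orP[]/eqP-> /orP[]/eqP->] | nX].
  - by rewrite nxx.
  - by rewrite (negPf nyx).
  - by rewrite exy /= ltnNge (ltnW lt_yx).
  - by rewrite nxx.
  case/andP=> -> ->; rewrite !andbT ?andTb.
  by apply: contraFN nX => /eqP[-> ->]; rewrite !eqxx orbT.
have [|s acs] := IHn (@invert_rel D0 X) (@invert_asym D0 X).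
  apply: leq_trans leb; apply: leq_ltn_trans (subset_leq_card sub) _.
  by rewrite [X in _ < X](cardsD1 (x, y)) inE /= exy lt_yx.
by exists (X :: s).
Qed.

Definition inversion_number (D : oriented_graph) : nat := ex_minn (decycling_exists D).

Definition dijoin_rel (L R : oriented_graph) : rel (L + R) :=
  fun a b => match a, b with
  | inl u, inl v => edge u v
  | inr u, inr v => edge u v
  | inl _, inr _ => true
  | inr _, inl _ => false
  end.

Lemma dijoin_asym (L R : oriented_graph) (a b : L + R) :
  dijoin_rel a b -> ~~ dijoin_rel b a.
Proof. by case: a b => [u|u] [v|v] //=; apply: edge_asym. Qed.

Definition dijoin (L R : oriented_graph) : oriented_graph :=
  OrientedGraph (@dijoin_asym L R).

(* Main.v *)
Require Import Defs.
From mathcomp Require Import all_boot.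

Set Implicit Arguments.
Unset Strict Implicit.
Unset Printing Implicit Defensive.

(* Suppose three inversions decycle [L -> R].  Give each vertex its membership *)
(* vector in F_2^3: an edge is reversed iff the vectors of its ends have dot   *)
(* product 1, and the final digraph is contained in a strict order [<].  For   *)
(* [w] in [R] the predicate [x_u . y_w = 1] is then upward closed in [u], and  *)
(* for [u] in [L] it is downward closed in [w].  If the vectors of [L], or of  *)
(* [R], span at most a line, one inversion suffices on that side.  Otherwise   *)
(* let [p = y1 * y2] and [q = x1 * x2] be nonzero cross products.              *)
(* - If some [y3] has [p . y3 = 1], then [x_u] is determined by the number of  *)
(*   [y_i] with [x_u . y_i = 1], which increases along [<].  So [L] splits     *)
(*   into a block of zero vectors below three blocks of constant vectors, and  *)
(*   one inversion makes the tournament of these three blocks transitive.      *)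
(*   The same holds for [R] if some [x3] has [q . x3 = 1].                     *)
(* - Otherwise [q] is orthogonal to [L] and [p] to [R].  If [p . q = 1], then  *)
(*   [q] plays the role of [y3].  If [p . q = 0], inverting the vertices of    *)
(*   [L] not orthogonal to [p], or those of [R] not orthogonal to [q], works.  *)

(** The upper bound 4 is [inversion_number_dijoin]. For the lower bound, a family of at most three
    sets is padded with empty sets to exactly three, and [decycled_dijoin3] then yields a single
    inversion decycling [L] or [R], against inversion number 2. Its cases rest on [decycled1_line]
    (dependent vectors), [decycled1_basis] (three independent tests) and [decycled1_plane] (vectors
    confined to a plane). *)

Definition ranked_by (T : Type) (lt e flip : rel T) : Prop :=
  forall u v, e u v -> if flip u v then lt v u else lt u v.

Definition ranked (T : Type) (e flip : rel T) : Prop :=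
  exists lt : rel T, [/\ irreflexive lt, transitive lt & ranked_by lt e flip].

Definition both_in (T : finType) (X : {set T}) : rel T :=
  fun u v => (u \in X) && (v \in X).

Definition flips (T : finType) (s : seq {set T}) : rel T :=
  fun u v => odd (count (fun X : {set T} => both_in X u v) s).

Definition decycled1 (T : finType) (e : rel T) : Prop :=
  exists X : {set T}, ranked e (both_in X).

(** * Decycling families and strict orders *)

Lemma acyclic_ranked (D : oriented_graph) :
  acyclic D <-> ranked (@edge D) (fun _ _ => false).
Proof.
split=> [/acyclicP/forallP acD | [lt [ltI ltT ltE]]].
  exists (fun u v => [exists w, edge u w && connect (@edge D) w v]); split.
  - move=> u; apply/existsP => -[w /andP[uw wu]].
    by have /forallP/(_ w)/implyP/(_ uw)/negP[] := acD u.
  - move=> v u w /= /existsP[a /andP[ua av]] /existsP[b /andP[vb bw]].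
    apply/existsP; exists a; rewrite ua (connect_trans av) //.
    exact: connect_trans (connect1 vb) bw.
  - by move=> u v uv; apply/existsP; exists v; rewrite uv connect0.
case=> [//|x p] /andP[cyc _]; exfalso.
have {cyc} /= pth: path lt x (rcons p x) by apply: sub_path cyc => u v; apply: ltE.
have := order_path_min ltT pth.
by rewrite all_rcons ltI.
Qed.

Lemma both_inC (T : finType) (X : {set T}) (u v : T) : both_in X u v = both_in X v u.
Proof. exact: andbC. Qed.

Lemma flipsC (T : finType) (s : seq {set T}) (u v : T) : flips s u v = flips s v u.
Proof. by rewrite /flips; congr odd; apply: eq_count => X; apply: both_inC. Qed.

Lemma flips_cons (T : finType) (X : {set T}) (s : seq {set T}) (u v : T) :
  flips (X :: s) u v = both_in X u v (+) flips s u v.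
Proof. by rewrite /flips /= oddD oddb. Qed.

(** Only the parity of the number of sets containing both ends of an edge matters; since [flips] is
    symmetric, the current direction of the edge does not. *)
Lemma ranked_invert (D : oriented_graph) (X : {set D}) (s : seq {set D}) :
  ranked (invert_rel X) (flips s) <-> ranked (@edge D) (flips (X :: s)).
Proof.
have invE u v : invert_rel X u v = if both_in X u v then edge v u else edge u v by [].
split=> -[lt [ltI ltT ltE]]; exists lt; split=> // u v.
  rewrite flips_cons; case Xuv: (both_in X u v) => /= uv; last first.
    by apply: ltE; rewrite invE Xuv.
  have /ltE: invert_rel X v u by rewrite invE both_inC Xuv.
  by rewrite flipsC; case: flips.
rewrite invE; case: ifP => Xuv /ltE; last by rewrite flips_cons Xuv.
by rewrite flips_cons both_inC Xuv flipsC /=; case: flips.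
Qed.

Lemma decycling_ranked (D : oriented_graph) (s : seq {set D}) :
  decycling s <-> ranked (@edge D) (flips s).
Proof.
(* Opening the record fixes the vertex type, so that the induction can vary the edge relation
   alone. *)
case: D s => V e0 e0_asym /= s; elim: s e0 e0_asym => [|X s IHs] e0 e0_asym.
  exact: acyclic_ranked.
pose D := OrientedGraph e0_asym.
exact: iff_trans (IHs (@invert_rel D X) (@invert_asym D X)) (@ranked_invert D X s).
Qed.

Lemma has_decycling_leq (D : oriented_graph) (k n : nat) :
  k <= n -> has_decycling D k -> has_decycling D n.
Proof.
move=> le_kn /has_decyclingP[s sz /decycling_ranked[lt [ltI ltT ltE]]].
apply/has_decyclingP; exists (s ++ nseq (n - k) set0).
  by rewrite size_cat size_nseq sz subnKC.
apply/decycling_ranked; exists lt; split=> // u v /ltE.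
by rewrite /flips count_cat count_nseq /both_in in_set0 mul0n addn0.
Qed.

Lemma has_decycling_geq (D : oriented_graph) (k : nat) :
  has_decycling D k -> inversion_number D <= k.
Proof. by move=> Dk; rewrite /inversion_number; case: ex_minnP => n _; apply. Qed.

Lemma decycled1_leq1 (D : oriented_graph) :
  decycled1 (@edge D) -> inversion_number D <= 1.
Proof.
case=> X [lt [ltI ltT ltE]]; apply: has_decycling_geq.
apply/has_decyclingP; exists [:: X] => //; apply/decycling_ranked.
by exists lt; split=> // u v /ltE; rewrite /flips /= addn0 oddb.
Qed.

Lemma inversion_number_ranked (D : oriented_graph) :
  exists2 s : seq {set D}, size s = inversion_number D & ranked (@edge D) (flips s).
Proof.
rewrite /inversion_number; case: ex_minnP => n /has_decyclingP[s sz ds] _.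
by exists s => //; apply/decycling_ranked.
Qed.

(** The two families act on separate sides and leave the joining edges alone, so the ordinal sum of
    the two orders serves. *)
Lemma inversion_number_dijoin (L R : oriented_graph) :
  inversion_number (dijoin L R) <= inversion_number L + inversion_number R.
Proof.
have [s <- [lt [ltI ltT ltE]]] := inversion_number_ranked L.
have [t <- [lt' [ltI' ltT' ltE']]] := inversion_number_ranked R.
apply: has_decycling_geq; apply/has_decyclingP.
exists ([seq (@inl L R) @: X | X : {set L} <- s]
        ++ [seq (@inr L R) @: X | X : {set R} <- t]).
  by rewrite size_cat !size_map.
have inl_in (X : {set L}) u : (inl u \in @inl L R @: X) = (u \in X).
  by apply: mem_imset => ? ? [].
have inr_in (X : {set R}) u : (inr u \in @inr L R @: X) = (u \in X).
  by apply: mem_imset => ? ? [].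
have inlr (X : {set L}) u : (inr u \in @inl L R @: X) = false.
  by apply/imsetP => -[].
have inrl (X : {set R}) u : (inl u \in @inr L R @: X) = false.
  by apply/imsetP => -[].
apply/decycling_ranked.
exists (fun a b => match a, b with
  | inl u, inl v => lt u v | inr u, inr v => lt' u v
  | inl _, inr _ => true | inr _, inl _ => false end).
split.
- by case=> u; [apply: ltI | apply: ltI'].
- by move=> [v|v] [u|u] [w|w] //; [apply: ltT | apply: ltT'].
rewrite /flips => -[u|u] [v|v] // uv; rewrite count_cat !count_map.
- rewrite (eq_count (a2 := fun X : {set L} => both_in X u v)); last first.
    by move=> X; rewrite /= /both_in !inl_in.
  rewrite (eq_count (a1 := preim _ _) (a2 := pred0)) ?count_pred0 ?addn0; first exact: ltE.
  by move=> X; rewrite /= /both_in !inrl.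
- rewrite (eq_count (a1 := preim _ _) (a2 := pred0)) ?count_pred0; last first.
    by move=> X; rewrite /= /both_in !inlr andbF.
  rewrite (eq_count (a1 := preim _ _) (a2 := pred0)) ?count_pred0 //.
  by move=> X; rewrite /= /both_in !inrl.
- rewrite (eq_count (a1 := preim _ _) (a2 := pred0)) ?count_pred0; last first.
    by move=> X; rewrite /= /both_in !inlr.
  rewrite (eq_count (a2 := fun X : {set R} => both_in X u v)); first exact: ltE'.
  by move=> X; rewrite /= /both_in !inr_in.
Qed.

(** * Vectors over the field with two elements *)

Definition vec := (bool * bool * bool)%type.

Definition vzero : vec := (false, false, false).

Definition vadd (a b : vec) : vec :=
  let: (a1, a2, a3) := a in let: (b1, b2, b3) := b in
  (a1 (+) b1, a2 (+) b2, a3 (+) b3).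

Definition dot (a b : vec) : bool :=
  let: (a1, a2, a3) := a in let: (b1, b2, b3) := b in
  a1 && b1 (+) a2 && b2 (+) a3 && b3.

Definition cross (a b : vec) : vec :=
  let: (a1, a2, a3) := a in let: (b1, b2, b3) := b in
  (a2 && b3 (+) a3 && b2, a3 && b1 (+) a1 && b3, a1 && b2 (+) a2 && b1).

Lemma dotC a b : dot a b = dot b a.
Proof. by move: a b => [[[] []] []] [[[] []] []]. Qed.

Lemma dot0v a : dot vzero a = false.
Proof. by case: a => [[? ?] ?]. Qed.

Lemma dotDl a b c : dot (vadd a b) c = dot a c (+) dot b c.
Proof. by move: a b c => [[[] []] []] [[[] []] []] [[[] []] []]. Qed.

Lemma dotDr a b c : dot c (vadd a b) = dot c a (+) dot c b.
Proof. by rewrite dotC dotDl !(dotC c). Qed.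

Lemma crossvv a : cross a a = vzero.
Proof. by move: a => [[[] []] []]. Qed.

Lemma cross0v a : cross vzero a = vzero.
Proof. by move: a => [[[] []] []]. Qed.

Lemma crossv0 a : cross a vzero = vzero.
Proof. by move: a => [[[] []] []]. Qed.

Lemma cross_eq0 a b : cross a b = vzero -> [\/ a = vzero, b = vzero | a = b].
Proof.
move: a b => [[[] []] []] [[[] []] []] //= _;
  by [apply: Or31 | apply: Or32 | apply: Or33].
Qed.

Lemma orthogonal_cross a b c : cross a b != vzero ->
  dot c a = false -> dot c b = false -> c = vzero \/ c = cross a b.
Proof. by move: a b c => [[[] []] []] [[[] []] []] [[[] []] []] //=; auto. Qed.

Lemma vadd_eq0 a b : vadd a b = vzero -> a = b.
Proof. by move: a b => [[[] []] []] [[[] []] []]. Qed.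

Lemma vadd_eq a b c : vadd a b = c -> a = vadd b c.
Proof. by move=> <-; move: a b => [[[] []] []] [[[] []] []]. Qed.

(** Nonzero isotropic vectors have weight 2, and two distinct ones share exactly one coordinate. *)
Lemma isotropic_eq p q : p != vzero -> q != vzero ->
  dot p p = false -> dot q q = false -> dot p q = false -> p = q.
Proof. by move: p q => [[[] []] []] [[[] []] []]. Qed.

Lemma dot_basis_inj (t1 t2 t3 a b : vec) : dot (cross t1 t2) t3 ->
  dot a t1 = dot b t1 -> dot a t2 = dot b t2 -> dot a t3 = dot b t3 -> a = b.
Proof.
move=> det e1 e2 e3; have c0 : cross t1 t2 != vzero.
  by apply: contraTneq det => ->; rewrite dot0v.
apply: vadd_eq0; case: (@orthogonal_cross t1 t2 (vadd a b)) => //.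
- by rewrite dotDl e1 addbb.
- by rewrite dotDl e2 addbb.
by move=> ab; move: det; rewrite -ab dotDl e3 addbb.
Qed.

(** Otherwise [x1] and [x2] both lie on the line orthogonal to [y1] and [y2], hence are
    dependent. *)
Lemma dot_nonzero (x1 x2 y1 y2 : vec) :
  cross x1 x2 != vzero -> cross y1 y2 != vzero ->
  exists h g, [/\ h = x1 \/ h = x2, g = y1 \/ g = y2 & dot h g].
Proof.
move=> cx cy.
case d11: (dot x1 y1); first by exists x1, y1; split; auto.
case d12: (dot x1 y2); first by exists x1, y2; split; auto.
case d21: (dot x2 y1); first by exists x2, y1; split; auto.
case d22: (dot x2 y2); first by exists x2, y2; split; auto.
case: (orthogonal_cross cy d11 d12) (orthogonal_cross cy d21 d22) cx => ->.
  by rewrite cross0v eqxx.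
by case=> ->; rewrite ?crossv0 ?crossvv eqxx.
Qed.

(** The plane orthogonal to [q] has basis [p], [h], and [dot c g] is the [h]-coordinate of [c]. The
    formula completes the square in the Gram form; this fails only when [p] is isotropic but not
    orthogonal to [h]. *)
Lemma plane_gram (p q g h a b : vec) :
  p != vzero -> q != vzero -> dot p g = false -> dot p q = false ->
  dot h q = false -> dot h g -> dot p p || ~~ dot p h ->
  dot a q = false -> dot b q = false ->
  dot a b = dot a p && dot b p (+)
            dot a g && dot b g && (dot h h (+) dot p h).
Proof.
move=> p0 q0 pg pq hq hg pph aq bq.
have qg0 : cross q g != vzero.
  apply/eqP => /cross_eq0[] e; move: hg q0 hq; rewrite e ?eqxx //.
  - by rewrite dotC dot0v.
  - by move=> ->.
have pE : p = cross q g.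
  by case: (orthogonal_cross qg0 pq pg) p0 => // ->; rewrite eqxx.
have decomp c : dot c q = false -> exists al be,
    c = vadd (if be then h else vzero) (if al then p else vzero).
  (* After removal of the [h]-part, what is left is orthogonal to [q] and [g], so it is zero or
     [p]. *)
  move=> cq; exists (vadd c (if dot c g then h else vzero) == p), (dot c g).
  apply: vadd_eq; set d := vadd _ _.
  have: d = vzero \/ d = cross q g.
    apply: orthogonal_cross => //; rewrite /d dotDl.
      by case: ifP; rewrite ?dot0v cq ?hq.
    by case: (dot c g); rewrite ?dot0v ?hg.
  rewrite -pE => -[]->; last by rewrite eqxx.
  by rewrite eq_sym (negPf p0).
have [al [be ->]] := decomp a aq; have [al' [be' ->]] := decomp b bq.
rewrite !(dotDl, dotDr) !(fun_if (fun c => dot c _)) !(fun_if (dot _)) !dot0v.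
rewrite ![dot _ vzero]dotC !dot0v pg hg !(dotC h p).
by move: pph; case: al be al' be' (dot p p) (dot p h) (dot h h)
  => [] [] [] [] [] [] [].
Qed.

(** * One inversion *)

(** Lets results about [L] be applied to [R] with all edges reversed. *)
Lemma decycled1_conv (T : finType) (e : rel T) :
  decycled1 (fun u v => e v u) -> decycled1 e.
Proof.
case=> X [lt [ltI ltT ltE]]; exists X, (fun u v => lt v u); split=> //.
  by move=> v u w vu wv; apply: ltT wv vu.
by move=> u v uv; have:= ltE v u uv; rewrite {1}/both_in andbC.
Qed.

Section OneInversion.

Variables (T : finType) (e lt : rel T) (x : T -> vec).
Hypotheses (ltI : irreflexive lt) (ltT : transitive lt).
Hypothesis ltE : ranked_by lt e (fun u v => dot (x u) (x v)).

(* [dot (x u) (x v) (+) both_in X u v] says whether the pair is still wrongly  *)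
(* oriented with respect to [lt] when only [X] is inverted; the order is       *)
(* repaired by permuting the blocks [key = i] and reversing some of them.      *)
Lemma decycled1_blocks (X : {set T}) (key : T -> nat) (rev : T -> bool) :
  (forall u v, key u = key v -> rev u = rev v) ->
  (forall u v, lt u v -> dot (x u) (x v) (+) both_in X u v =
     if key u == key v then rev u else key v < key u) ->
  decycled1 e.
Proof.
move=> revE H; exists X.
exists (fun u v => (key u < key v) || (key u == key v) &&
                   (if rev u then lt v u else lt u v)); split.
- by move=> u; rewrite ltnn eqxx ltI if_same.
- move=> v u w.
  case: (ltngtP (key u) (key v)) => // [uv _|uv] /=.
    by case/orP=> [vw|/andP[/eqP<- _]]; rewrite ?uv // (ltn_trans uv vw).
  rewrite uv (revE u v uv); case: (ltngtP (key v) (key w)) => //= _.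
  by case: ifP => _; [move=> vu wv; apply: ltT wv vu | apply: ltT].
move=> u v /ltE; case: ifP => duv.
  move=> vu; move: (H v u vu) (revE v u); rewrite dotC duv both_inC.
  by case: (both_in X u v) => /=;
    case: (ltngtP (key u) (key v)) => //= kk rv /(_ (esym kk)) ruv; rewrite -?ruv -rv.
move=> uv; move: (H u v uv) (revE u v); rewrite duv.
by case: (both_in X u v) => /=;
  case: (ltngtP (key u) (key v)) => //= kk ru /(_ kk) ruv; rewrite -?ruv -ru.
Qed.

(** All nonzero vectors coincide, so the flipped pairs are those inside one set, which is empty if
    that vector is isotropic. *)
Lemma decycled1_line :
  (forall u v, cross (x u) (x v) = vzero) -> decycled1 e.
Proof.
move=> c0; apply: (decycled1_blocks (X := [set u | dot (x u) (x u)])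
  (key := fun=> 0) (rev := fun=> false)) => // u v _.
rewrite /= /both_in !inE.
have [->|->|->] := cross_eq0 (c0 u v); rewrite ?dot0v //.
  by rewrite dotC !dot0v andbF.
by rewrite andbb addbb.
Qed.

(** Satisfied by the vector of a vertex [w] of the other side, which separates the two classes in
    the order. It compares all pairs across the classes, hence is stronger than upward closure. *)
Definition upclosed (t : vec) : Prop :=
  forall u v, ~~ dot (x u) t -> dot (x v) t -> lt u v.

Lemma upclosed_mono (t : vec) (u v : T) :
  upclosed t -> lt u v -> dot (x u) t -> dot (x v) t.
Proof.
by move=> up uv ut; apply/idPn => vt; move: (ltT uv (up _ _ vt ut)); rewrite ltI.
Qed.

(** By [plane_gram], inverting the vertices not orthogonal to [p] leaves at most the final block
    [dot (x u) g] to be reversed as a whole. *)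
Lemma decycled1_plane (p q g h : vec) :
  p != vzero -> q != vzero -> dot p g = false -> dot p q = false ->
  dot h q = false -> dot h g -> dot p p || ~~ dot p h ->
  (forall u, dot (x u) q = false) -> upclosed g -> decycled1 e.
Proof.
move=> p0 q0 pg pq hq hg pph xq up.
apply: (decycled1_blocks (X := [set u | dot (x u) p])
  (key := fun u => dot (x u) g)
  (rev := fun u => dot (x u) g && (dot h h (+) dot p h))) => u v.
  by case: (dot (x u) g) (dot (x v) g) => [] [].
move/(upclosed_mono up).
rewrite (plane_gram p0 q0 pg pq hq hg pph (xq u) (xq v)) /both_in !inE.
by rewrite addbAC addbb; case: (dot (x u) g) (dot (x v) g) => [] [] // /(_ isT).
Qed.

Lemma decycled1_basis (t1 t2 t3 : vec) : dot (cross t1 t2) t3 ->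
  upclosed t1 -> upclosed t2 -> upclosed t3 -> decycled1 e.
Proof.
move=> det up1 up2 up3.
pose lev u := dot (x u) t1 + dot (x u) t2 + dot (x u) t3.
have lev_mono u v : lt u v -> lev u <= lev v.
  have mono t : upclosed t -> lt u v -> dot (x u) t <= dot (x v) t.
    by move=> /upclosed_mono up /up; case: (dot (x u) t) => // ->.
  by move=> uv; rewrite !leq_add // mono.
(* The sets of vertices having product 1 with [t1], [t2], [t3] form a chain, so their number at a
   vertex tells which ones contain it. *)
have nested t t' u v : upclosed t -> upclosed t' -> ~~ dot (x u) t ->
    dot (x v) t -> dot (x u) t' -> dot (x v) t'.
  by move=> up up' ut vt; apply: upclosed_mono => //; apply: up.
have lev_inj u v : lev u = lev v -> x u = x v.
  move=> luv; suff [? ? ?] : [/\ dot (x u) t1 = dot (x v) t1,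
    dot (x u) t2 = dot (x v) t2 & dot (x u) t3 = dot (x v) t3].
    exact: dot_basis_inj det _ _ _.
  move: luv (nested _ _ u v up1 up2) (nested _ _ u v up1 up3)
    (nested _ _ u v up2 up3) (nested _ _ v u up1 up2) (nested _ _ v u up1 up3)
    (nested _ _ v u up2 up3); rewrite /lev.
  case: (dot (x u) t1) (dot (x u) t2) (dot (x u) t3) (dot (x v) t1)
    (dot (x v) t2) (dot (x v) t3) => [] [] [] [] [] [] //= _ n1 n2 n3 n4 n5 n6;
    by have // : false by [apply: n1 | apply: n2 | apply: n3 | apply: n4 | apply: n5 | apply: n6].
(* [F i] is the common vector of level [i]; empty levels get [vzero]. *)
pose F i := if [pick u | lev u == i] is Some u then x u else vzero.
have xF u : x u = F (lev u).
  rewrite /F; case: pickP => [v /eqP/lev_inj-> //|/(_ u)].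
  by rewrite eqxx.
have F0 : F 0 = vzero.
  rewrite /F; case: pickP => [v|//]; rewrite /lev => lv0.
  apply: (dot_basis_inj det); rewrite dot0v; move: lv0;
    by case: (dot _ t1) (dot _ t2) (dot _ t3) => [] [] [].
have lev_lt4 u : lev u < 4.
  by rewrite /lev; case: (dot _ t1) (dot _ t2) (dot _ t3) => [] [] [].
pose a := dot (F 1) (F 2); pose b := dot (F 1) (F 3); pose c := dot (F 2) (F 3).
(* The tournament on the blocks 1, 2, 3 is cyclic iff [cyc]; inverting the     *)
(* blocks 1 and 3 then fixes it.  [keyl] sorts the blocks by indegree.         *)
pose cyc := (a == c) && (a != b).
pose keyl i := nth 0 [:: 0; 1 + a + (b (+) cyc); 1 + ~~ a + c;
                         1 + ~~ (b (+) cyc) + ~~ c] i.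
have keyl_inj u v : keyl (lev u) = keyl (lev v) -> lev u = lev v.
  move: (lev u) (lev v) (lev_lt4 u) (lev_lt4 v); rewrite /keyl /cyc.
  by move=> [|[|[|[|?]]]] [|[|[|[|?]]]] // _ _; case: (a) (b) (c) => [] [] [].
apply: (decycled1_blocks (X := [set u | cyc && odd (lev u)])
  (key := fun u => keyl (lev u))
  (rev := fun u => dot (x u) (x u) (+) (cyc && odd (lev u)))) => u v.
  by move/keyl_inj => luv; rewrite (lev_inj _ _ luv) luv.
move=> /lev_mono; rewrite /both_in !inE !xF.
move: (lev u) (lev v) (lev_lt4 u) (lev_lt4 v) => [|[|[|[|i]]]] [|[|[|[|j]]]] // _ _ _;
  rewrite ?F0 ?dot0v ?andbF ?andbT ?andbb ?eqxx //= -/a -/b -/c /keyl /cyc /=;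
  by case: (a) (b) (c) => [] [] [].
Qed.

End OneInversion.

(** * The dijoin *)

Lemma decycled_dijoin3 (L R : oriented_graph) :
  has_decycling (dijoin L R) 3 -> decycled1 (@edge L) \/ decycled1 (@edge R).
Proof.
case/has_decyclingP=> -[|X1 [|X2 [|X3 []]]] // _ /decycling_ranked[lt [ltI ltT ltE]].
pose z (a : dijoin L R) : vec := (a \in X1, a \in X2, a \in X3).
have zE a b : flips [:: X1; X2; X3] a b = dot (z a) (z b).
  by rewrite /flips /= !oddD !oddb /both_in addbF addbA.
pose x u := z (inl u); pose y w := z (inr w).
(* The order on [R] is reversed so that [upclosed] describes both sides. *)
pose ltL u v := lt (inl u) (inl v); pose ltR v w := lt (inr w) (inr v).
have ltLI : irreflexive ltL by move=> u; apply: ltI.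
have ltRI : irreflexive ltR by move=> u; apply: ltI.
have ltLT : transitive ltL by move=> v u w; apply: ltT.
have ltRT : transitive ltR by move=> v u w uv vw; apply: ltT vw uv.
have ltLE : ranked_by ltL (@edge L) (fun u v => dot (x u) (x v)).
  by move=> u v uv; have:= ltE (inl u) (inl v) uv; rewrite zE.
have ltRE : ranked_by ltR (fun v w => @edge R w v) (fun v w => dot (y v) (y w)).
  by move=> u v uv; have:= ltE (inr v) (inr u) uv; rewrite zE dotC.
have ltLR u w : if dot (x u) (y w) then lt (inr w) (inl u) else lt (inl u) (inr w).
  by have:= ltE (inl u) (inr w) isT; rewrite zE.
have upL w : upclosed ltL x (y w).
  move=> u v uw vw; apply: (@ltT (inr w)).
    by have:= ltLR u w; rewrite (negPf uw).
  by have:= ltLR v w; rewrite vw.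
have upR u : upclosed ltR y (x u).
  move=> v w; rewrite ![dot (y _) _]dotC => uv uw; apply: (@ltT (inl u)).
    by have:= ltLR u w; rewrite uw.
  by have:= ltLR u v; rewrite (negPf uv).
have decL t1 t2 t3 := @decycled1_basis _ _ _ _ ltLI ltLT ltLE t1 t2 t3.
have decR t1 t2 t3 := @decycled1_basis _ _ _ _ ltRI ltRT ltRE t1 t2 t3.
have [/existsP[u1 /existsP[u2 q0]]|lineL] :=
    boolP [exists u1, exists u2, cross (x u1) (x u2) != vzero]; last first.
  left; apply: (decycled1_line ltLI ltLT ltLE) => u v; apply/eqP.
  by move/existsPn: lineL => /(_ u)/existsPn/(_ v)/negPn.
have [/existsP[w1 /existsP[w2 p0]]|lineR] :=
    boolP [exists w1, exists w2, cross (y w1) (y w2) != vzero]; last first.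
  right; apply/decycled1_conv; apply: (decycled1_line ltRI ltRT ltRE) => u v.
  by apply/eqP; move/existsPn: lineR => /(_ u)/existsPn/(_ v)/negPn.
set q := cross (x u1) (x u2) in q0; set p := cross (y w1) (y w2) in p0.
have [/existsP[w3 det]|yp] := boolP [exists w, dot p (y w)].
  by left; apply: decL det _ _ _.
have [/existsP[u3 det]|xq] := boolP [exists u, dot q (x u)].
  by right; apply/decycled1_conv; apply: decR det _ _ _.
have {}yp w : dot (y w) p = false by rewrite dotC; apply/negbTE; move/existsPn: yp.
have {}xq u : dot (x u) q = false by rewrite dotC; apply/negbTE; move/existsPn: xq.
case pq: (dot p q).
  (* [q] is orthogonal to every [x u], so it is vacuously [upclosed]. *)
  by left; apply: decL pq _ _ _ => // u v _; rewrite xq.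
have [h [g [hE gE hg]]] := dot_nonzero q0 p0.
have [u0 hu] : exists u, h = x u by case: hE => ->; [exists u1 | exists u2].
have [w0 gw] : exists w, g = y w by case: gE => ->; [exists w1 | exists w2].
subst h g.
have pg : dot p (y w0) = false by rewrite dotC.
have qh : dot q (x u0) = false by rewrite dotC.
have [okL|nokL] := boolP (dot p p || ~~ dot p (x u0)).
  by left; apply: (decycled1_plane ltLI ltLT ltLE p0 q0 pg pq (xq u0) hg).
have [okR|nokR] := boolP (dot q q || ~~ dot q (y w0)).
  right; apply/decycled1_conv.
  apply: (decycled1_plane ltRI ltRT ltRE q0 p0 qh _ (yp w0) _ okR yp (upR u0)).
    by rewrite dotC.
  by rewrite dotC.
(* If both sides fail, [p] and [q] are isotropic and orthogonal, hence equal; but [x u0] is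
   orthogonal to [q] and not to [p]. *)
exfalso; move: nokL nokR; rewrite !negb_or !negbK => /andP[/negbTE pp ph] /andP[/negbTE qq _].
by rewrite (isotropic_eq p0 q0 pp qq pq) qh in ph.
Qed.

Theorem theorem1p3 (L R : oriented_graph)
  (hL : inversion_number L = 2) (hR : inversion_number R = 2) :
  inversion_number (dijoin L R) = 4.
Proof.
apply/eqP; rewrite eqn_leq; apply/andP; split.
  by rewrite -[4]/(2 + 2) -{1}hL -hR inversion_number_dijoin.
rewrite ltnNge; apply/negP => le3.
have [s sz /decycling_ranked ds] := inversion_number_ranked (dijoin L R).
have /decycled_dijoin3[] : has_decycling (dijoin L R) 3.
- by apply: has_decycling_leq le3 _; apply/has_decyclingP; exists s.
- by move/decycled1_leq1; rewrite hL.
- by move/decycled1_leq1; rewrite hR.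
Qed.
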